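(* Let $n\geq 3$, let $G=D_{2n}=\langle a,b : a^n=b^2=e,\ b^{-1}ab=a^{-1}\rangle$, and let $H=\langle a^sb\rangle$, where $0\leq s\leq n-1$. Let $(\alpha,\beta)\neq(0,0)$ be a pair of non-negative integers. Then $H$ is an $(\alpha,\beta)$-regular set of $G$ if and only if $(\alpha,\beta)=(1,1)$.
   Context: $D_{2n}$ is the dihedral group of order $2n$. An element $x$ of a group $G$ is a square if $x=y^2$ for some $y\in G$. A subset of $G$ is square-free if none of its elements is a square of $G$; a subset $S$ is normal if $g^{-1}Sg=S$ for all $g\in G$. For a normal square-free subset $S$ of $G$ (possibly empty), the Cayley sum graph $\mathrm{CayS}(G,S)$ is the simple graph with vertex set $G$ in which $x,y$ are adjacent if and only if $xy\in S$. A set $C$ of vertices of a graph is an $(\alpha,\beta)$-regular set in the graph if every vertex in $C$ is adjacent to exactly $\alpha$ vertices of $C$ and every vertex not in $C$ is adjacent to exactly $\beta$ vertices of $C$. A subset $C\subseteq G$ is an $(\alpha,\beta)$-regular set of $G$ if it is an $(\alpha,\beta)$-regular set in $\mathrm{CayS}(G,S)$ for some normal square-free subset $S$ of $G$. *)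

(* Defs.v *)
From mathcomp Require Import all_boot all_fingroup all_solvable.

Set Implicit Arguments.
Unset Strict Implicit.
Unset Printing Implicit Defensive.

Import GroupScope.

Section Graph.

Variable T : finType.

(* The graph has vertex set V; only the restriction of e to V is relevant. *)
Definition regular_set_in (V : {set T}) (e : rel T) (C : {set T})
    (alpha beta : nat) : Prop :=
  [/\ C \subset V,
      forall x, x \in C -> #|[set y in C | e x y]| = alpha
    & forall x, x \in V :\: C -> #|[set y in C | e x y]| = beta].

End Graph.

Section CayleySum.

Variables (gT : finGroupType) (G : {group gT}).

Definition is_square (x : gT) : Prop := exists2 y, y \in G & x = y ^+ 2.

Definition square_free (S : {set gT}) : Prop :=
  forall x, x \in S -> ~ is_square x.

Definition normal_subset (S : {set gT}) : Prop :=
  S \subset G /\ forall g, g \in G -> S :^ g = S.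

Definition cayS (S : {set gT}) : rel gT := [rel x y | x * y \in S].

Definition regular_set (C : {set gT}) (alpha beta : nat) : Prop :=
  exists S : {set gT},
    [/\ normal_subset S, square_free S & regular_set_in G (cayS S) C alpha beta].

(* cayS S is the adjacency relation of a simple graph on G: x != y need not be
   imposed, since S is square-free. *)
Lemma cayS_irr (S : {set gT}) :
  square_free S -> {in G, forall x, ~~ cayS S x x}.
Proof. by move=> Ssf x Gx; apply/negP=> /Ssf; apply; exists x. Qed.

Lemma cayS_sym (S : {set gT}) :
  normal_subset S -> {in G &, symmetric (cayS S)}.
Proof.
case=> _ nS x y Gx _; rewrite /cayS /=.
have -> : y * x = (x * y) ^ x by rewrite conjgE mulgA mulKg.
by rewrite -{2}(nS x Gx) memJ_conjg.
Qed.

End CayleySum.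

(* Main.v *)
(* Write c = a^s b.  The vertex 1 has [c \in S] neighbours in H = {1, c}, while
   the vertex a^2, which lies outside H because n >= 3, has
   [a^2 \in S] + [a^2 c \in S] = [c \in S] neighbours in H, because a^2 is a
   square and a^2 c = a c a^-1 is a conjugate of c.  Hence alpha = beta <= 1.
   Conversely S = G \ <a> realises (1, 1), since <a> has index 2. *)
Require Import Defs.
From mathcomp Require Import all_boot all_fingroup all_solvable.

Set Implicit Arguments.
Unset Strict Implicit.
Unset Printing Implicit Defensive.

Import GroupScope.

(** The index matters only when [x] and [y] both lie outside [K]: then [K :* y^-1] is the one
    nontrivial coset [G :\: K], which contains [x]. *)
Lemma mem_mul_index2 (gT : finGroupType) (G K : {group gT}) (x y : gT) :
  K \subset G -> #|G : K| = 2 -> x \in G -> y \in G ->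
  (x * y \in K) = ((x \in K) == (y \in K)).
Proof.
move=> sKG iK Gx Gy; have [Kx | nKx] := boolP (x \in K).
  by rewrite groupMl //; case: (y \in K).
have [Ky | nKy] := boolP (y \in K); first by rewrite groupMr // (negbTE nKx).
have Dy : y^-1 \in G :\: K by rewrite inE !groupV nKy.
have : x \in K :* y^-1 by rewrite (rcoset_index2 sKG iK Dy) inE nKx.
by rewrite mem_rcoset invgK.
Qed.

Lemma card_cayS_involution (gT : finGroupType) (S : {set gT}) (c x : gT) :
  #[c] = 2 ->
  #|[set y in <[c]> | cayS S x y]| = ((x \in S) + ((x * c)%g \in S))%N.
Proof.
move=> oc; have c1 : 1 \notin [set c] by rewrite inE eq_sym -order_eq1 oc.
rewrite cycle2g // -sum1dep_card big_mkcondr /= big_setU1 //= big_set1.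
rewrite /cayS /= mulg1.
by do 2!case: (_ \in S).
Qed.

(** Since [G] is [<[a]> * <[b]>], [2 * n <= #[a] * #[b] <= n * 2], which forces [#[a] = n]. If [b]
    were in [<[a]>], then [G] would be [<[a]>], of index 1. *)
Lemma dihedral_rotations (n : nat) (gT : finGroupType) (G : {group gT})
    (a b : gT) :
  0 < n -> #|G| = (2 * n)%N -> <<[set a; b]>> = G ->
  a ^+ n = 1 -> b ^+ 2 = 1 -> a ^ b = a^-1 ->
  [/\ #[a] = n, b \notin <[a]> & #|G : <[a]>| = 2].
Proof.
move=> n_gt0 oG hab ha hb hJ.
have sAG : <[a]> \subset G by rewrite cycle_subG -hab mem_gen ?set21.
have nAb : <[b]> \subset 'N(<[a]>).
  by rewrite cycle_subG inE -cycleJ hJ cycleV.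
have defG : <[a]> * <[b]> = G.
  by rewrite -norm_joinEr // -hab joing_idl joing_idr.
have le_an : #[a] <= n by rewrite dvdn_leq // order_dvdn ha.
have le_b2 : #[b] <= 2 by rewrite dvdn_leq // order_dvdn hb.
have oab : #|G| <= #[a] * #[b].
  by rewrite !orderE mul_cardG defG leq_pmulr.
have oa : #[a] = n.
  apply/eqP; rewrite eqn_leq le_an -(leq_pmul2l (m := 2)) // -oG.
  by rewrite (leq_trans oab) // mulnC leq_mul2r le_b2 orbT.
have iA : #|G : <[a]>| = 2 by rewrite -divgS // oG -orderE oa mulnK.
split=> //; apply: contra_eqN iA => Ab.
by rewrite -defG mulGSid ?cycle_subG // indexgg.
Qed.

(** As [b^-1 = b], the square is [a ^+ i * (a ^+ i) ^ b], and conjugation by [b] inverts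
    [a ^+ i]. *)
Lemma dihedral_reflection_sqr (gT : finGroupType) (a b : gT) (i : nat) :
  b ^+ 2 = 1 -> a ^ b = a^-1 -> (a ^+ i * b) ^+ 2 = 1.
Proof.
move=> hb hJ; have bV : b^-1 = b by apply/eqP; rewrite eq_invg_mul -expg2 hb.
rewrite expg2 -{1}bV -!mulgA -conjgE conjXg hJ expgVn.
exact: mulgV.
Qed.

Theorem theorem3p4 (n : nat) (hn : 3 <= n)
    (gT : finGroupType) (G : {group gT}) (hG : G \isog 'D_(2 * n))
    (a b : gT) (hab : <<[set a; b]>> = G)
    (ha : a ^+ n = 1) (hb : b ^+ 2 = 1) (hJ : b^-1 * a * b = a^-1)
    (s : nat) (hs : 0 <= s <= n - 1)
    (alpha beta : nat) (h0 : (alpha, beta) <> (0, 0)) :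
  regular_set G <[a ^+ s * b]> alpha beta <-> (alpha, beta) = (1%N, 1%N).
Proof.
have n_gt1 : 1 < n by apply: leq_trans hn.
have n_gt0 : 0 < n by apply: leq_trans hn.
have oG : #|G| = (2 * n)%N by rewrite (card_isog hG) mul2n card_dihedral.
have aJ : a ^ b = a^-1 by rewrite conjgE mulgA.
have [oa nAb iA] := dihedral_rotations n_gt0 oG hab ha hb aJ.
have Ga : a \in G by rewrite -hab mem_gen ?set21.
have Gb : b \in G by rewrite -hab mem_gen ?set22.
have sAG : <[a]> \subset G by rewrite cycle_subG.
have sqr_c := dihedral_reflection_sqr s hb aJ.
have nAc : a ^+ s * b \notin <[a]> by rewrite groupMl ?mem_cycle.
have c_conj : a ^+ 2 * (a ^+ s * b) = (a ^+ s * b) ^ a^-1.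
  have ba : b * a^-1 = a * b by rewrite -aJ -conjgC.
  rewrite conjgE invgK -(mulgA (a ^+ s)) ba.
  by rewrite (mulgA (a ^+ s)) -expgSr (expgS a s) !mulgA.
have Gc : a ^+ s * b \in G by rewrite groupM ?groupX.
(* The reflection becomes a variable [c]: only these four facts about it are used below. *)
move: (a ^+ s * b) sqr_c nAc c_conj Gc => c sqr_c nAc c_conj Gc.
have oc : #[c] = 2.
  by apply: nt_prime_order => //; apply: contraNneq nAc => ->.
split=> [[S [[sSG nSG] sfS [_ hin hout]]] | [-> ->]].
- have nSsq x : x \in G -> x ^+ 2 \notin S.
    by move=> Gx; apply/negP=> /sfS[]; exists x.
  have hA : alpha = (c \in S).
    rewrite -(hin 1 (group1 _)) card_cayS_involution // mul1g.
    (* The term [1 \in S] vanishes because [1 = 1 ^+ 2] is a square. *)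
    by rewrite -(expg1n gT 2) (negbTE (nSsq 1 _)).
  have hB : beta = (c \in S).
    have a2H : a ^+ 2 \in G :\: <[c]>.
      (* [a ^+ 2] differs from [1] because [n >= 3] does not divide 2, and from [c] because [c] is
         not a rotation. *)
      rewrite inE (groupX 2 Ga) andbT cycle2g // !inE negb_or -order_dvdn oa.
      by rewrite gtnNdvd //=; apply: contraNneq nAc => <-; apply: mem_cycle.
    rewrite -(hout _ a2H) card_cayS_involution // (negbTE (nSsq a _)) //.
    by rewrite c_conj -{1}(nSG a^-1) ?groupV // memJ_conjg.
  (* If [c] is not in [S], the pair is [(0, 0)], which [h0] excludes. *)
  by move: h0; rewrite hA hB; case: (c \in S).
(* As [c] lies outside [<[a]>], exactly one of [x] and [x * c] does. *)
have cnt x : x \in G -> #|[set y in <[c]> | cayS (G :\: <[a]>) x y]| = 1%N.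
  move=> Gx; rewrite card_cayS_involution // !inE Gx (groupM Gx Gc) !andbT.
  by rewrite (mem_mul_index2 sAG iA) // (negbTE nAc); case: (x \in _).
exists (G :\: <[a]>); split.
- split=> [|g Gg]; first exact: subsetDl.
  have /normal_norm/subsetP/(_ g Gg)/normP nAg := index2_normal sAG iA.
  by rewrite conjDg conjGid // nAg.
(* Every square of [G] lies in the index 2 subgroup [<[a]>]. *)
- move=> x /setDP[_ /negP nAx] [y Gy xy]; apply: nAx.
  by rewrite xy expg2 (mem_mul_index2 sAG iA) // eqxx.
split=> [|x Hx|x /setDP[Gx _]]; first by rewrite cycle_subG.
  by apply: cnt; move: x Hx; apply/subsetP; rewrite cycle_subG.
exact: cnt.
Qed.
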